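(* Let $\pi^{(1)},\ldots,\pi^{(m)}$ be product orders on $\{0,1\}^n$ (each given by a tuple of $n$ linear orders on $\{0,1\}$), and let $\mathcal{L}_{\pi^{(s)}}\subseteq\mathbb{R}^{\{0,1\}^n}$ be the cone of $\pi^{(s)}$-supermodular functions. Then the Minkowski sum $\mathcal{L}_{\pi^{(1)}}+\cdots+\mathcal{L}_{\pi^{(m)}}$ is a convex polyhedral cone whose facet inequalities are exactly the facet-defining inequalities that are common to all $m$ cones $\mathcal{L}_{\pi^{(1)}},\ldots,\mathcal{L}_{\pi^{(m)}}$.
   Context: Fix $X=\{0,1\}^n$. A tuple $\pi=(\pi_1,\ldots,\pi_n)$ of linear orders on $\{0,1\}$ defines the product order: $x\le_\pi y$ iff $x_i\le_{\pi_i}y_i$ for all $i\in[n]=\{1,\ldots,n\}$. This is a lattice order, with meet $\wedge$ and join $\vee$ depending on $\pi$. A function $f:X\to\mathbb{R}$ is $\pi$-supermodular if $f(x)+f(y)\le f(x\wedge y)+f(x\vee y)$ for all $x,y\in X$; the set of these functions is the polyhedral cone $\mathcal{L}_\pi\subseteq\mathbb{R}^X$. The sign vector $\tau\in\{\pm1\}^n$ of $\pi$ has $\tau_i=1$ if $0<_{\pi_i}1$ and $\tau_i=-1$ if $1<_{\pi_i}0$. Identify binary vectors with their support sets in $[n]$. The facet-defining inequalities of $\mathcal{L}_\pi$ are the signed elementary imset inequalities $$\tau_i\tau_j\bigl(f(z)+f(z\cup\{i,j\})-f(z\cup\{i\})-f(z\cup\{j\})\bigr)\ge 0,$$ one for each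 unordered pair $i\ne j$ in $[n]$ and each $z\subseteq[n]\setminus\{i,j\}$. The Minkowski sum of cones is the set of all sums of one element from each. If no inequality is common to all the cones, the cone with no facet inequalities is the whole space $\mathbb{R}^X$. *)

(* Defs.v *)
From HB Require Import structures.
From mathcomp Require Import all_boot all_order all_algebra.
From mathcomp Require Import classical_sets reals.
Set Implicit Arguments.
Unset Strict Implicit.
Unset Printing Implicit Defensive.
Import Order.TTheory GRing.Theory Num.Theory.
Local Open Scope ring_scope.

Definition linear_order (r : rel bool) : Prop :=
  [/\ reflexive r, antisymmetric r, transitive r & total r].

(* A point of {0,1}^n is represented by its support x : {set 'I_n}, so its
   i-th coordinate is the boolean i \in x, with 0 = false and 1 = true. *)
Section ProductOrder.
Variables (n : nat) (pi : 'I_n -> rel bool).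

Definition prod_le (x y : {set 'I_n}) : Prop :=
  forall i : 'I_n, pi i (i \in x) (i \in y).

Definition prod_meet (x y : {set 'I_n}) : {set 'I_n} :=
  [set i | if pi i (i \in x) (i \in y) then i \in x else i \in y].

Definition prod_join (x y : {set 'I_n}) : {set 'I_n} :=
  [set i | if pi i (i \in x) (i \in y) then i \in y else i \in x].

Lemma prod_meetP (x y z : {set 'I_n}) : (forall i, linear_order (pi i)) ->
  prod_le z (prod_meet x y) <-> prod_le z x /\ prod_le z y.
Proof.
move=> lin; split=> [h|[hx hy] i]; last first.
  by rewrite inE; case: ifP => _; [apply: hx | apply: hy].
split=> i; have := h i; rewrite inE; have [rf _ tr to] := lin i.
  case: ifP => // yx zy; apply: tr zy _.
  by have := to (i \in x) (i \in y); rewrite yx.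
by case: ifP => // xy zx; apply: tr zx xy.
Qed.

Lemma prod_joinP (x y z : {set 'I_n}) : (forall i, linear_order (pi i)) ->
  prod_le (prod_join x y) z <-> prod_le x z /\ prod_le y z.
Proof.
move=> lin; split=> [h|[hx hy] i]; last first.
  by rewrite inE; case: ifP => _; [apply: hy | apply: hx].
split=> i; have := h i; rewrite inE; have [rf _ tr to] := lin i.
  by case: ifP => // xy yz; apply: tr xy yz.
case: ifP => // yx xz; apply: tr xz.
by have := to (i \in x) (i \in y); rewrite yx.
Qed.

End ProductOrder.

(* The regular module R^o makes this space of functions on {0,1}^n a vectType
   over R. *)
Notation fun_space R n := {ffun {set 'I_n} -> R^o}.

Section Cones.
Variables (R : realType) (n : nat).
Local Notation V := (fun_space R n).

Definition supermodular_cone (pi : 'I_n -> rel bool) : set V :=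
  [set f : V | forall x y : {set 'I_n},
     f x + f y <= f (prod_meet pi x y) + f (prod_join pi x y)]%classic.

Definition minkowski_sum (m : nat) (C : 'I_m -> set V) : set V :=
  [set f : V | exists g : 'I_m -> V,
     (forall s, C s (g s)) /\ f = \sum_(s < m) g s]%classic.

(* A coefficient vector a : V stands for the homogeneous linear inequality
   0 <= dot a f in the unknown f. *)
Definition dot (a f : V) : R := \sum_(x : {set 'I_n}) a x * f x.

Definition polyhedral_cone (C : set V) : Prop :=
  exists A : seq V, forall f : V, C f <-> (forall a, a \in A -> 0 <= dot a f).

Definition is_span (C : set V) (U : {vspace V}) : Prop :=
  forall W : {vspace V}, (U <= W)%VS <-> (forall f : V, C f -> f \in W).

(* The dimension of a cone is that of its affine hull, which is its linear span
   because a cone contains 0; the same holds for its faces. *)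
Definition facet_inequality (C : set V) (a : V) : Prop :=
  (forall f, C f -> 0 <= dot a f) /\
  exists U W : {vspace V},
    [/\ is_span C U,
        is_span [set f | C f /\ dot a f = 0]%classic W
      & \dim U = (\dim W).+1].

Definition order_sign (r : rel bool) : R := if r false true then 1 else -1.

Definition indicator (w : {set 'I_n}) : V := [ffun x => (x == w)%:R].

Definition signed_imset (pi : 'I_n -> rel bool) (i j : 'I_n) (z : {set 'I_n})
    : V :=
  (order_sign (pi i) * order_sign (pi j)) *:
    (indicator z + indicator (z :|: [set i; j])
     - indicator (z :|: [set i]) - indicator (z :|: [set j])).

Definition imset_inequality (pi : 'I_n -> rel bool) (a : V) : Prop :=
  exists (i j : 'I_n) (z : {set 'I_n}),
    [/\ i != j, z \subset ~: [set i; j] & a = signed_imset pi i j z].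

Lemma dot_signed_imset (pi : 'I_n -> rel bool) i j z (f : V) :
  dot (signed_imset pi i j z) f =
    order_sign (pi i) * order_sign (pi j) *
      (f z + f (z :|: [set i; j]) - f (z :|: [set i]) - f (z :|: [set j])).
Proof.
have dotI w : \sum_x indicator w x * f x = f w.
  rewrite (bigD1 w) //= ffunE eqxx mul1r big1 ?addr0 // => x /negPf xw.
  by rewrite ffunE xw mul0r.
rewrite -!dotI -big_split /= -sumrB -sumrB mulr_sumr; apply: eq_bigr => x _.
by rewrite !ffunE /GRing.scale /= -!mulrA !mulrBl !mulrDl.
Qed.

End Cones.

(* Main.v *)
Require Import Defs.
From HB Require Import structures.
From mathcomp Require Import all_boot all_order all_algebra.
From mathcomp Require Import ring lra.
From mathcomp Require Import boolp classical_sets reals.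
From mathcomp Require Import fintype finset.
Set Implicit Arguments.
Unset Strict Implicit.
Unset Printing Implicit Defensive.
Import Order.TTheory GRing.Theory Num.Theory.
Local Open Scope ring_scope.

(** A sum of supermodular functions satisfies every inequality shared by the
    cones; the content of the theorem is that nothing else constrains such a
    sum, and that none of the shared inequalities is redundant.  Both halves
    rest on one function: with tau the sign vector of pi, the function
    q_pi (x) = (sum of tau_k over k in x)^2 / 2 has second difference
    tau_i tau_j on every square spanned by i and j ([dot_sign_square]).

    Minkowski sum ([minkowski_sum_imsetP]).  Supermodularity is local: flipping
    the coordinates on which 1 precedes 0 turns a product order into inclusion,
    and there the inequality for x, y telescopes into inequalities on
    elementary squares ([supermodular_imsetP]).  Suppose f satisfies the common
    inequalities.  The functions Q_s = sum_t (q_s - q_t) add up to 0, and the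
    (i, j) inequality of the order s takes on Q_s the value
    sum_t (1 - sigma^s_ij sigma^t_ij), where sigma_ij = tau_i tau_j.  This is 0
    if all orders agree on the sign of the pair, and positive otherwise.  So
    for M large (M Q_s + f) / m is pi^(s)-supermodular: where the signs agree
    because f satisfies the common inequality, elsewhere because M Q_s
    dominates.  These m functions add up to f.

    Facets ([equal_norm_facetP]).  Let a cone be cut out by finitely many
    vectors b of the same squared norm N, all taking the value 1 on one
    function q; elementary imsets have N = 4, and q_pi serves as q.  On
    q - b / N the inequality b is tight, and by strictness in Cauchy-Schwarz
    every other b' is positive, so the face of b spans the whole hyperplane
    orthogonal to b.  Conversely, on a facet of a, some b has to vanish:
    otherwise a sum of points of the facet would be interior to the cone, and
    moving from it along -a would stay in the cone and violate a.  That b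
    vanishes on the hyperplane spanned by the facet, hence is proportional to
    a, and evaluating at q shows the factor to be positive.

    As all imsets have the same norm, a vector that is a positive multiple of
    an imset of each order is a multiple of one and the same imset; hence
    the inequalities that are facets of every cone are the positive multiples
    of common imsets ([common_facetP]). *)

(** * Domination by a large multiple *)

(** The finite form of the statement that an interior point can absorb any
    perturbation once it is scaled up; entries at which [u] vanishes cannot be
    improved by scaling, which is why [v] must be nonnegative there. *)
Lemma scale_dominates (R : realFieldType) (T : eqType) (r : seq T)
    (u v : T -> R) :
  (forall t, t \in r -> 0 <= u t /\ (u t = 0 -> 0 <= v t)) ->
  exists M, forall t, t \in r -> 0 <= M * u t + v t.
Proof.
elim: r => [|t0 r IH] uv; first by exists 0.
have [t tr|M hM] := IH; first by apply: uv; rewrite inE tr orbT.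
have [u0 v0] := uv t0 (mem_head _ _).
exists (`|M| + `|v t0| / u t0) => t; rewrite inE => /predU1P [->|tr].
  have [u00|u0N] := eqVneq (u t0) 0; first by rewrite u00 mulr0 add0r v0.
  rewrite mulrDl divfK // -addrA addr_ge0 ?mulr_ge0 //.
  by have := lerNnormlW (lexx `|v t0|); rewrite -subr_ge0 opprK addrC.
have [ut _] : 0 <= u t /\ (u t = 0 -> 0 <= v t).
  by apply: uv; rewrite inE tr orbT.
apply: le_trans (hM t tr) _; rewrite lerD2r ler_wpM2r //.
by apply: le_trans (ler_norm M) _; rewrite lerDl divr_ge0.
Qed.

(** * The inner product on functions *)

Section InnerProduct.
Variables (R : realType) (n : nat).
Local Notation V := (fun_space R n).
Implicit Types (a b f : V).

Fact dot_is_linear a : linear (dot a : V -> R^o).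
Proof.
move=> c f g; rewrite /dot /GRing.scale /= mulr_sumr -big_split /=.
by apply: eq_bigr => x _; rewrite !ffunE /GRing.scale /=; ring.
Qed.

HB.instance Definition _ a :=
  GRing.isLinear.Build R V R^o _ (dot a : V -> R^o) (dot_is_linear a).

Lemma dotC a b : dot a b = dot b a.
Proof. by apply: eq_bigr => x _; rewrite mulrC. Qed.

Lemma dotDr a f g : dot a (f + g) = dot a f + dot a g.
Proof. exact: (linearD (dot a : V -> R^o)). Qed.

Lemma dotBr a f g : dot a (f - g) = dot a f - dot a g.
Proof. exact: (linearB (dot a : V -> R^o)). Qed.

Lemma dotZr a c f : dot a (c *: f) = c * dot a f.
Proof. exact: (linearZ_LR (dot a : V -> R^o)). Qed.

Lemma dot_sumr a (I : Type) (r : seq I) (P : pred I) (F : I -> V) :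
  dot a (\sum_(i <- r | P i) F i) = \sum_(i <- r | P i) dot a (F i).
Proof. exact: (linear_sum (dot a : V -> R^o)). Qed.

Lemma dot0r a : dot a 0 = 0.
Proof. exact: (linear0 (dot a : V -> R^o)). Qed.

Lemma dot0l f : dot 0 f = 0.
Proof. by rewrite dotC dot0r. Qed.

Lemma dotBl a b f : dot (a - b) f = dot a f - dot b f.
Proof. by rewrite dotC dotBr !(dotC f). Qed.

Lemma dotZl c a f : dot (c *: a) f = c * dot a f.
Proof. by rewrite dotC dotZr dotC. Qed.

Lemma dot_ge0 a : 0 <= dot a a.
Proof. by apply: sumr_ge0 => x _; rewrite -expr2 sqr_ge0. Qed.

Lemma dot_eq0 a : (dot a a == 0) = (a == 0).
Proof.
apply/eqP/eqP => [a0|->]; last first.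
  by apply: big1 => x _; rewrite ffunE mul0r.
apply/ffunP => x; rewrite ffunE.
have /eqP : dot a a = 0 by [].
rewrite psumr_eq0 => [/allP /(_ x)|y _]; last by rewrite -expr2 sqr_ge0.
by rewrite mem_index_enum -expr2 sqrf_eq0 => /(_ isT) /eqP.
Qed.

Lemma dot_gt0 a : (0 < dot a a) = (a != 0).
Proof. by rewrite lt0r dot_ge0 andbT dot_eq0. Qed.

Definition orthogonal_hyperplane a : {vspace V} :=
  lker (linfun (dot a : V -> R^o)).

Lemma mem_orthogonal a f : (f \in orthogonal_hyperplane a) = (dot a f == 0).
Proof. by rewrite memv_ker lfunE. Qed.

Lemma dim_orthogonal a :
  a != 0 -> \dim (fullv : {vspace V}) = (\dim (orthogonal_hyperplane a)).+1.
Proof.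
move=> a0; rewrite -(limg_ker_dim (linfun (dot a : V -> R^o)) fullv).
rewrite capfv -addn1; congr (_ + _)%N; apply/eqP; rewrite eqn_leq.
have := dimvS (subvf (limg (linfun (dot a : V -> R^o)))).
rewrite dimvf /dim /= => -> /=; rewrite lt0n dimv_eq0.
apply: contra a0 => /eqP h; rewrite -dot_eq0.
have := memv_img (linfun (dot a : V -> R^o)) (memvf a).
by rewrite h memv0 lfunE.
Qed.

End InnerProduct.

(** * Facets of cones cut out by vectors of equal norm *)

Section EqualNormFacets.
Variables (R : realType) (n : nat).
Local Notation V := (fun_space R n).
Implicit Types (C D : set V) (B : seq V).

Lemma is_span_mem C U f : is_span C U -> C f -> f \in U.
Proof. by move=> CU; apply: (CU U).1; apply: subvv. Qed.

Lemma is_span_unique C U U' : is_span C U -> is_span C U' -> U = U'.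
Proof.
move=> CU CU'; apply/eqP; rewrite eqEsubv; apply/andP; split.
  by apply/(CU U') => f; apply: is_span_mem CU'.
by apply/(CU' U) => f; apply: is_span_mem CU.
Qed.

(** [p] is a relative interior point of the cone [D] inside the subspace [H]:
    an inequality tight at [p] holds on all of [H].  Any [f] in [H] is then the
    difference of the elements M p + f and M p of [D], for M large. *)
Lemma is_span_relint D B (H : {vspace V}) p :
  (forall f, D f <-> f \in H /\ forall b, b \in B -> 0 <= dot b f) ->
  D p ->
  (forall b, b \in B -> dot b p = 0 -> forall f, f \in H -> 0 <= dot b f) ->
  is_span D H.
Proof.
move=> DE Dp p_int W; split=> [/subvP HW f /DE[fH _]|DW]; first exact: HW.
apply/subvP => f fH; have [pH p0] := (DE p).1 Dp.
have [b bB|M hM] :=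
  @scale_dominates R _ B (fun b => dot b p) (fun b => dot b f).
  by split=> [|bp]; [apply: p0 | apply: p_int bp _ fH].
have DMp c : (forall b, b \in B -> 0 <= c * dot b p) -> D (c *: p).
  by move=> hc; apply/DE; split=> [|b bB]; rewrite ?memvZ ?dotZr ?hc.
have MpfW : `|M| *: p + f \in W.
  apply/DW/DE; split=> [|b bB]; first by rewrite memvD ?memvZ.
  rewrite dotDr dotZr; apply: le_trans (hM b bB) _.
  by rewrite lerD2r ler_wpM2r ?ler_norm ?p0.
rewrite -(addKr (`|M| *: p) f) addrC memvB //.
by apply/DW/DMp => b bB; rewrite mulr_ge0 ?p0.
Qed.

(** For [b] to be a facet there must be a point of the cone at which [b] is the
    only tight inequality; q - b / N is one, because equal norms make the
    value of [b'] on it equal to |b' - b|^2 / (2 N).  The function [q] also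
    makes the cone full-dimensional, so that a facet spans a hyperplane and
    determines its normal vector up to a factor. *)
Lemma equal_norm_facetP C B (N : R) (q : V) :
  (forall f, C f <-> forall b, b \in B -> 0 <= dot b f) ->
  (forall b, b \in B -> dot b b = N) ->
  (forall b, b \in B -> dot b q = 1) ->
  forall a, facet_inequality C a <->
    exists c b, [/\ 0 < c, b \in B & a = c *: b].
Proof.
move=> CE BN Bq a.
have Cspan : is_span C fullv.
  apply: (@is_span_relint _ B _ q) => [f||b bB].
  - by rewrite CE; split=> [fB|[]//]; split; rewrite ?memvf.
  - by apply/CE => b /Bq ->.
  - by rewrite Bq // => /eqP; rewrite oner_eq0.
have Cq : C q by apply/CE => b /Bq ->.
split=> [[aC [U [W [CU aW dimUW]]]]|[c [b [c0 bB ->]]]]; last first.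
  have b_neq0 : b != 0.
    apply/eqP => b0; have := Bq b bB; rewrite b0 dot0l => /eqP.
    by rewrite eq_sym oner_eq0.
  have N0 : 0 < N by rewrite -(BN b bB) dot_gt0.
  split=> [f /CE fB|]; first by rewrite dotZl mulr_ge0 ?fB // ltW.
  exists fullv, (orthogonal_hyperplane b).
  split=> //; last exact: dim_orthogonal.
  have p_b b' : b' \in B ->
      dot b' (q - N^-1 *: b) = (2 * N)^-1 * dot (b' - b) (b' - b).
    move=> b'B; rewrite !dotBr !dotBl dotZr !BN // (dotC b b') Bq //.
    by field; rewrite gt_eqF.
  apply: (@is_span_relint _ B _ (q - N^-1 *: b)) => [f||b' b'B].
  - rewrite /mkset mem_orthogonal dotZl CE; split=> [[fB /eqP]|[/eqP bf0 fB]].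
      by rewrite mulf_eq0 gt_eqF.
    by rewrite bf0 mulr0.
  - split; first apply/CE => b' b'B.
      by rewrite p_b // mulr_ge0 ?dot_ge0 // invr_ge0 mulr_ge0 // ltW.
    by rewrite dotZl p_b // subrr dot0l !mulr0.
  - rewrite p_b // => /eqP; rewrite mulf_eq0 invr_eq0 mulf_eq0 (gt_eqF N0).
    rewrite pnatr_eq0 /= dot_eq0 subr_eq0 => /eqP -> f.
    by rewrite mem_orthogonal => /eqP ->.
have Wa f : f \in W -> dot a f = 0.
  have /subvP sub : (W <= orthogonal_hyperplane a)%VS.
    by apply/aW => g [_ ag0]; rewrite mem_orthogonal ag0.
  by move/sub; rewrite mem_orthogonal => /eqP.
have UE := is_span_unique CU Cspan.
have a_neq0 : a != 0.
  apply/eqP => a0; have : (U <= W)%VS.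
    apply/CU => f Cf; apply: is_span_mem aW _; split=> //.
    by rewrite a0 dot0l.
  by move=> /dimvS; rewrite dimUW ltnn.
have WE : W = orthogonal_hyperplane a.
  apply/eqP; rewrite eqEdim; apply/andP; split.
    by apply/subvP => f /Wa; rewrite mem_orthogonal => ->.
  by rewrite -ltnS -dim_orthogonal // -UE dimUW.
(* If no [b] vanished on the face, summing one witness per [b] would give a
   point of the face in the interior of the cone. *)
have [b bB b0] : exists2 b, b \in B &
    forall f, C f -> dot a f = 0 -> dot b f = 0.
  apply: contrapT => noB.
  have /choice [w w_pos] : forall b, exists f, [/\ C f, dot a f = 0 &
      b \in B -> 0 < dot b f].
    move=> b; have [bB|] := boolP (b \in B); last first.
      exists 0; split=> //; last exact: dot0r.
      by apply/CE => b' _; rewrite dot0r.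
    apply: contrapT => nof; apply: noB; exists b => // f Cf af0.
    apply/eqP/contraT => bf0; exfalso; apply: nof; exists f; split=> // _.
    by rewrite lt0r bf0 (CE f).1.
  pose p : V := \sum_(b <- B) w b.
  have p_pos b : b \in B -> 0 < dot b p.
    move=> bB; have [_ _ /(_ bB) wb] := w_pos b.
    rewrite dot_sumr (big_rem b) //= ltr_wpDr //.
    by apply: sumr_ge0 => b' _; have [/CE /(_ b bB)] := w_pos b'.
  have [b bB|M hM] :=
    @scale_dominates R _ B (fun b => dot b p) (fun b => - dot b a).
    by split=> [|bp]; have := p_pos b bB; [exact: ltW | rewrite bp ltxx].
  have /aC : C (M *: p - a).
    by apply/CE => b bB; rewrite dotBr dotZr hM.
  rewrite dotBr dotZr dot_sumr big1 => [|b _]; last by have [] := w_pos b.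
  by rewrite mulr0 sub0r oppr_ge0 leNgt dot_gt0 a_neq0.
have b0W f : dot a f = 0 -> dot b f = 0.
  move=> af0; apply/eqP; rewrite -mem_orthogonal.
  have /subvP : (W <= orthogonal_hyperplane b)%VS.
    by apply/aW => g [Cg ag0]; rewrite mem_orthogonal b0.
  by apply; rewrite WE mem_orthogonal af0.
(* [k *: a] is the projection of [b] on the line of [a]; the difference is
   orthogonal to [a], hence also to [b], hence to itself. *)
pose k := dot a b / dot a a.
have aa0 : dot a a != 0 by rewrite dot_eq0.
have bE : b = k *: a.
  apply/eqP; rewrite -subr_eq0 -dot_eq0 dotBl dotZl.
  have av : dot a (b - k *: a) = 0 by rewrite dotBr dotZr divfK // subrr.
  by rewrite av mulr0 subr0 b0W.
have kq : k * dot a q = 1 by rewrite -dotZl -bE Bq.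
have k0 : 0 < k.
  rewrite -(pmulr_lgt0 _ (_ : 0 < dot a q)) ?kq ?ltr01 //.
  rewrite lt0r aC // andbT; apply/eqP => aq; move: kq.
  by rewrite aq mulr0 => /eqP; rewrite eq_sym oner_eq0.
exists k^-1, b; split; rewrite ?invr_gt0 //.
by rewrite bE scalerA mulVf ?scale1r // gt_eqF.
Qed.

End EqualNormFacets.

(** * Supermodularity for inclusion *)

Section BooleanSupermodularity.
Variables (R : realType) (n : nat).
Implicit Types (g : {set 'I_n} -> R) (x y z : {set 'I_n}).

Definition square g i j z : R :=
  g z + g (z :|: [set i; j]) - g (z :|: [set i]) - g (z :|: [set j]).

(** The inequality on squares says that the increment of [g] on adding [i] does
    not decrease when [j] joins the set.  Adding the elements of B :\: A one at
    a time extends this to increments at A \subset B, and adding the elements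
    of D one at a time to increments along a set D.  The case
    A = x :&: y, B = y, D = x :\: y is supermodularity. *)
Lemma supermodular_of_squares g :
  (forall i j z, i != j -> z \subset ~: [set i; j] -> 0 <= square g i j z) ->
  forall x y, g x + g y <= g (x :&: y) + g (x :|: y).
Proof.
move=> g_sq x y.
have mono1 k : forall i (A B : {set 'I_n}),
    A \subset B -> i \notin B -> #|B :\: A| = k ->
    g (i |: A) - g A <= g (i |: B) - g B.
  elim: k => [|k IH] i A B AB iB.
    move/eqP; rewrite cards_eq0 setD_eq0 => BA.
    by have -> : A = B by apply/eqP; rewrite eqEsubset AB.
  move=> kE; have /card_gt0P [j] : (0 < #|B :\: A|)%N by rewrite kE.
  rewrite inE => /andP [jA jB].
  have ij : i != j by apply: contraNneq iB => ->.
  have iA : i \notin A by apply: contra iB => /(subsetP AB).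
  apply: le_trans (IH i (j |: A) B _ iB _); last 2 first.
  - by rewrite subUset sub1set jB.
  - by move: kE; rewrite (cardsD1 j) !inE jA jB setUC -setDDl; case.
  have := g_sq i j A ij; rewrite /square => /(_ _) sq.
  have /sq : A \subset ~: [set i; j].
    by apply/subsetP => l lA; rewrite !inE negb_or; apply/andP; split;
      apply: contraTneq lA => ->.
  by rewrite (setUC A) -setUA (setUC A) (setUC A); lra.
have mono k : forall D A B : {set 'I_n},
    A \subset B -> [disjoint D & B] -> #|D| = k ->
    g (D :|: A) - g A <= g (D :|: B) - g B.
  elim: k => [|k IH] D A B AB DB.
    by move/eqP; rewrite cards_eq0 => /eqP ->; rewrite !set0U !subrr.
  move=> kE; have /card_gt0P [i iD] : (0 < #|D|)%N by rewrite kE.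
  have D'k : #|D :\ i| = k by move: kE; rewrite (cardsD1 i) iD; case.
  have D'B : [disjoint D :\ i & B].
    by apply: disjointWl DB; apply: subD1set.
  have iB : i \notin D :\ i :|: B.
    by rewrite !inE eqxx /= (disjointFr DB iD).
  have := IH _ _ _ AB D'B D'k.
  have := mono1 _ _ _ _ (setUS (D :\ i) AB) iB erefl.
  by rewrite !setUA !setD1K //; lra.
have DB : [disjoint x :\: y & y].
  rewrite -setI_eq0; apply/eqP/setP => k.
  by rewrite !inE; case: (k \in y); rewrite ?andbF.
have := mono _ _ _ _ (subsetIr x y) DB erefl.
rewrite (setUC _ (x :&: y)) setID (setUC _ y).
have -> : y :|: x :\: y = x :|: y.
  by apply/setP => k; rewrite !inE; case: (k \in x); case: (k \in y).
by lra.
Qed.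

Lemma square_ge0 g i j z :
  (forall x y, g x + g y <= g (x :&: y) + g (x :|: y)) ->
  i != j -> z \subset ~: [set i; j] -> 0 <= square g i j z.
Proof.
move=> g_sup ij zij; have := g_sup (z :|: [set i]) (z :|: [set j]).
rewrite -setUIr -setUUr; have -> : [set i] :&: [set j] = set0.
  by apply/eqP; rewrite setI_eq0 disjoints1 inE.
by rewrite setU0 /square; lra.
Qed.

End BooleanSupermodularity.

(** * From inclusion to product orders *)

Section ProductOrders.
Variables (R : realType) (n : nat).
Local Notation V := (fun_space R n).
Implicit Types (pi : 'I_n -> rel bool) (f : V).

Lemma linear_order_bool (r : rel bool) a b : linear_order r ->
  r a b = if r false true then a ==> b else b ==> a.
Proof.
case=> rr ra _ rt; have := ra false true; have := rt false true.
by case: a b => [] []; rewrite ?rr /=; case: (r false true);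
  case: (r true false) => //= ? /(_ isT).
Qed.

(** An isomorphism, in either direction, between the product order of [pi] and
    inclusion: it exchanges 0 and 1 where 1 precedes 0. *)
Definition flip pi (x : {set 'I_n}) : {set 'I_n} :=
  [set i | if pi i false true then i \in x else i \notin x].

Lemma flipK pi : involutive (flip pi).
Proof.
by move=> x; apply/setP => i; rewrite !inE; case: (pi i _ _); rewrite ?negbK.
Qed.

Lemma prod_meet_flip pi x y : (forall i, linear_order (pi i)) ->
  prod_meet pi x y = flip pi (flip pi x :&: flip pi y).
Proof.
move=> lin; apply/setP => i; rewrite !inE (linear_order_bool _ _ (lin i)).
by case: (pi i _ _); case: (i \in x); case: (i \in y).
Qed.

Lemma prod_join_flip pi x y : (forall i, linear_order (pi i)) ->
  prod_join pi x y = flip pi (flip pi x :|: flip pi y).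
Proof.
move=> lin; apply/setP => i; rewrite !inE (linear_order_bool _ _ (lin i)).
by case: (pi i _ _); case: (i \in x); case: (i \in y).
Qed.

Lemma subset_notin (i j : 'I_n) (z : {set 'I_n}) :
  z \subset ~: [set i; j] -> i \notin z /\ j \notin z.
Proof.
by rewrite -disjoints_subset disjoint_sym => h; split;
  rewrite (disjointFr h) // !inE eqxx ?orbT.
Qed.

(** Flipping permutes the four corners of the square at [z], and exchanges the
    positive corners with the negative ones exactly when just one of [i] and [j]
    is reversed, that is, when the sign of the imset is -1. *)
Lemma dot_signed_imset_flip pi (i j : 'I_n) (z : {set 'I_n}) f :
  i != j -> z \subset ~: [set i; j] ->
  dot (signed_imset R pi i j z) f =
    square (f \o flip pi) i j (flip pi z :\: [set i; j]).
Proof.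
move=> ij /subset_notin [iz jz].
(* [P w a b] is the corner of the square at [w] whose coordinates at [i] and
   [j] are the booleans [a] and [b]. *)
pose P (w : {set 'I_n}) a b :=
  w :|: [set k | (a && (k == i)) || (b && (k == j))].
have P00 w : w = P w false false by apply/setP => k; rewrite !inE orbF.
have P11 w : w :|: [set i; j] = P w true true.
  by apply/setP => k; rewrite !inE.
have P10 w : w :|: [set i] = P w true false.
  by apply/setP => k; rewrite !inE orbF.
have P01 w : w :|: [set j] = P w false true by apply/setP => k; rewrite !inE.
have flipP a b : flip pi (P (flip pi z :\: [set i; j]) a b) =
    P z (a == pi i false true) (b == pi j false true).
  apply/setP => k; rewrite !inE.
  have [->|ki] := eqVneq k i.
    rewrite (negPf iz) (negPf ij) !andbT !andbF !orbF /=.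
    by case: (pi i _ _); case: a.
  have [->|kj] := eqVneq k j.
    by rewrite (negPf jz) !andbT !andbF /=; case: (pi j _ _); case: b.
  by rewrite !andbF !orbF /=; case: (pi k _ _); rewrite ?negbK.
have squareE h w : square h i j w = h (P w false false) + h (P w true true)
    - h (P w true false) - h (P w false true) :> R.
  by rewrite /square P11 P10 P01 -P00.
rewrite dot_signed_imset -/(square f i j z) !squareE /= !flipP /order_sign.
by case: (pi i _ _); case: (pi j _ _) => /=; ring.
Qed.

Lemma supermodular_imsetP pi f : (forall i, linear_order (pi i)) ->
  supermodular_cone pi f <->
    forall b, imset_inequality pi b -> 0 <= dot b f.
Proof.
move=> lin; have flip_notin i j (z : {set 'I_n}) :
    flip pi z :\: [set i; j] \subset ~: [set i; j].
  by apply/subsetP => k; rewrite !inE => /andP [].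
split=> [f_sup _ [i [j [z [ij zij ->]]]]|f_imset x y].
  rewrite dot_signed_imset_flip //; apply: square_ge0 => // x y /=.
  have := f_sup (flip pi x) (flip pi y).
  by rewrite prod_meet_flip // prod_join_flip // !flipK.
rewrite prod_meet_flip // prod_join_flip //.
rewrite -[X in f X + _ <= _](flipK pi) -[X in _ + f X <= _](flipK pi).
apply: (@supermodular_of_squares _ _ (f \o flip pi)) => i j z ij zij.
have -> : z = flip pi (flip pi z :\: [set i; j]) :\: [set i; j].
  apply/setP => k; rewrite !inE; have [iz jz] := subset_notin zij.
  have [->|_] := eqVneq k i; first exact: negbTE.
  have [->|_] := eqVneq k j; first exact: negbTE.
  by case: (pi k _ _); rewrite ?negbK.
rewrite -dot_signed_imset_flip //; apply: f_imset.
by exists i, j, (flip pi z :\: [set i; j]).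
Qed.

(** * The quadratic function of a sign vector *)

Definition sign_product pi (i j : 'I_n) : R :=
  order_sign R (pi i) * order_sign R (pi j).

Lemma sign_product_sqr pi i j : sign_product pi i j * sign_product pi i j = 1.
Proof.
by rewrite /sign_product /order_sign; do 2 case: ifP => _; ring.
Qed.

Lemma sign_product_le1 pi pi' i j :
  sign_product pi i j * sign_product pi' i j <= 1.
Proof.
by rewrite /sign_product /order_sign; do 4 case: ifP => _; lra.
Qed.

Definition sign_square pi : V :=
  [ffun x : {set 'I_n} => (\sum_(k in x) order_sign R (pi k)) ^+ 2 / 2].

(** With t the sum of the signs over [z], the second difference is that of
    t^2 / 2 in the steps tau_i and tau_j, namely their product. *)
Lemma dot_sign_square pi pi' (i j : 'I_n) (z : {set 'I_n}) :
  i != j -> z \subset ~: [set i; j] ->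
  dot (signed_imset R pi i j z) (sign_square pi') =
    sign_product pi i j * sign_product pi' i j.
Proof.
move=> ij /subset_notin [iz jz]; rewrite dot_signed_imset !ffunE.
rewrite (setUC z [set i]) (setUC z [set j]) (setUC z [set i; j]) -setUA.
rewrite !big_setU1 ?inE ?negb_or ?ij ?iz ?jz //= /sign_product.
by field.
Qed.

Lemma dot_imset_sign_square pi (b : V) : imset_inequality pi b ->
  dot b (sign_square pi) = 1.
Proof.
by case=> i [j [z [ij zij ->]]]; rewrite dot_sign_square ?sign_product_sqr.
Qed.

(** An imset has entries 1 or -1 at the four distinct corners of a square. *)
Lemma imset_norm pi (b : V) : imset_inequality pi b -> dot b b = 4.
Proof.
case=> i [j [z [ij /subset_notin [iz jz] ->]]].
have neq (w w' : {set 'I_n}) k : (k \in w) != (k \in w') -> (w == w') = false.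
  by move=> kw; apply: contraNF kw => /eqP ->.
have ji : j != i by rewrite eq_sym.
have z_ij : (z == z :|: [set i; j]) = false.
  by apply: (neq _ _ i); rewrite !inE (negPf iz) eqxx.
have z_i : (z == z :|: [set i]) = false.
  by apply: (neq _ _ i); rewrite !inE (negPf iz) eqxx.
have z_j : (z == z :|: [set j]) = false.
  by apply: (neq _ _ j); rewrite !inE (negPf jz) eqxx.
have ij_i : (z :|: [set i; j] == z :|: [set i]) = false.
  by apply: (neq _ _ j); rewrite !inE (negPf jz) eqxx orbT (negPf ji).
have ij_j : (z :|: [set i; j] == z :|: [set j]) = false.
  by apply: (neq _ _ i); rewrite !inE (negPf iz) eqxx (negPf ij).
have i_j : (z :|: [set i] == z :|: [set j]) = false.
  by apply: (neq _ _ i); rewrite !inE (negPf iz) eqxx (negPf ij).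
rewrite dot_signed_imset !ffunE !eqxx (eq_sym _ z) z_ij.
rewrite !(eq_sym (z :|: [set i]) z) !(eq_sym (z :|: [set j]) z) z_i z_j.
rewrite !(eq_sym (z :|: [set i]) (z :|: [set i; j])) ij_i.
rewrite !(eq_sym (z :|: [set j]) (z :|: [set i; j])) ij_j.
rewrite !(eq_sym (z :|: [set j]) (z :|: [set i])) i_j /GRing.scale /=.
by rewrite /order_sign; do 2 case: ifP => _; ring.
Qed.

End ProductOrders.

(** * Imset inequalities common to several orders *)

Section CommonImsets.
Variables (R : realType) (n m : nat) (pi : 'I_m -> 'I_n -> rel bool).
Hypothesis m_gt0 : (0 < m)%N.
Hypothesis pi_linear : forall s i, linear_order (pi s i).
Local Notation V := (fun_space R n).

Definition common_imset (b : V) : Prop := forall s, imset_inequality (pi s) b.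

Lemma common_imset_finite :
  exists B : seq V, forall b, b \in B <-> common_imset b.
Proof.
pose all_imsets := [seq signed_imset R (pi (Ordinal m_gt0)) x.1.1 x.1.2 x.2
  | x <- enum {: 'I_n * 'I_n * {set 'I_n}}].
exists [seq b <- all_imsets | `[< common_imset b >]] => b.
rewrite mem_filter; split=> [/andP [/asboolP]|b_common] //.
apply/andP; split; first exact/asboolP.
have [i [j [z [_ _ ->]]]] := b_common (Ordinal m_gt0).
by apply/mapP; exists (i, j, z); rewrite ?mem_enum.
Qed.

(** Every term of the sum is nonnegative, so each sign product at [i], [j]
    equals the one of [s], and then the signed imsets themselves coincide. *)
Lemma agreeing_signs_common s (i j : 'I_n) (z : {set 'I_n}) :
  i != j -> z \subset ~: [set i; j] ->
  \sum_t (1 - sign_product R (pi s) i j * sign_product R (pi t) i j) = 0 ->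
  common_imset (signed_imset R (pi s) i j z).
Proof.
move=> ij zij /eqP; rewrite psumr_eq0 => [/allP agree t|t _]; last first.
  by rewrite subr_ge0 sign_product_le1.
exists i, j, z; split=> //; congr (_ *: _); rewrite -!/(sign_product R _ i j).
have := agree t; rewrite mem_index_enum subr_eq0 => /(_ isT) /eqP st1.
by rewrite -[RHS]mul1r st1 -mulrA sign_product_sqr mulr1.
Qed.

(** The summands q s add up to 0 and are strictly positive on every
    inequality of the order [s] for a pair on which the orders disagree, so
    f can be split evenly and each part corrected by a large multiple of q s. *)
Lemma minkowski_sum_imsetP (f : V) :
  minkowski_sum (fun s => supermodular_cone (pi s)) f <->
  forall b, common_imset b -> 0 <= dot b f.
Proof.
split=> [[g [g_sup ->]] b b_common|f_common].
  rewrite dot_sumr; apply: sumr_ge0 => s _.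
  by apply: (supermodular_imsetP _ (pi_linear s)).1 (b_common s).
pose q s : V := \sum_t (sign_square R (pi s) - sign_square R (pi t)).
have dot_q s (i j : 'I_n) (z : {set 'I_n}) :
    i != j -> z \subset ~: [set i; j] ->
    dot (signed_imset R (pi s) i j z) (q s) =
    \sum_t (1 - sign_product R (pi s) i j * sign_product R (pi t) i j).
  move=> ij zij; rewrite dot_sumr; apply: eq_bigr => t _.
  by rewrite dotBr !dot_sign_square // sign_product_sqr.
have sum_q : \sum_s q s = 0.
  rewrite /q; under eq_bigr do rewrite sumrB.
  by rewrite sumrB exchange_big subrr.
pose I : finType := ('I_m * ('I_n * 'I_n * {set 'I_n}))%type.
(* One index set for all the orders, so that a single [M] serves them all. *)
pose r := [seq x : I <- enum I |
  (x.2.1.1 != x.2.1.2) &&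
  ((x.2.2 : {set 'I_n}) \subset ~: [set x.2.1.1; x.2.1.2])].
pose imset_of (x : I) :=
  signed_imset R (pi x.1) x.2.1.1 x.2.1.2 x.2.2.
have [[s [[i j] z]]|M hM] := @scale_dominates R _ r
    (fun x => dot (imset_of x) (q x.1)) (fun x => dot (imset_of x) f).
  rewrite mem_filter /= => /andP [/andP [ij zij] _]; rewrite dot_q //.
  split; first by apply: sumr_ge0 => t _; rewrite subr_ge0 sign_product_le1.
  by move=> agree; apply: f_common; apply: agreeing_signs_common.
exists (fun s => m%:R^-1 *: (M *: q s + f)); split=> [s|]; last first.
  rewrite -scaler_sumr big_split /= -scaler_sumr sum_q scaler0 add0r.
  rewrite sumr_const card_ord -scaler_nat scalerA mulVf ?scale1r //.
  by rewrite pnatr_eq0 -lt0n.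
apply/(supermodular_imsetP _ (pi_linear s)) => _ [i [j [z [ij zij ->]]]].
rewrite dotZr mulr_ge0 ?invr_ge0 // dotDr dotZr.
by apply: (hM (s, (i, j, z))); rewrite mem_filter /= ij zij mem_enum.
Qed.

Lemma common_imset_facetP (C : set V) :
  (forall f, C f <-> forall b, common_imset b -> 0 <= dot b f) ->
  forall a, facet_inequality C a <->
    exists c b, [/\ 0 < c, common_imset b & a = c *: b].
Proof.
move=> CE a; have [B BE] := common_imset_finite.
have s0 := Ordinal m_gt0.
have aP := @equal_norm_facetP R n C B 4 (sign_square R (pi s0)) _ _ _ a.
rewrite aP; last 3 first.
- by move=> f; rewrite CE; split=> h b /BE; apply: h.
- by move=> b /BE /(_ s0); apply: imset_norm.
- by move=> b /BE /(_ s0); apply: dot_imset_sign_square.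
by split=> -[c [b [c0 /BE hb ->]]]; exists c, b.
Qed.

End CommonImsets.

(** A single order is the case of a constant family. *)
Lemma supermodular_facetP (R : realType) (n : nat) (pi : 'I_n -> rel bool)
    (a : fun_space R n) : (forall i, linear_order (pi i)) ->
  facet_inequality (supermodular_cone pi) a <->
    exists c b, [/\ 0 < c, imset_inequality pi b & a = c *: b].
Proof.
move=> lin.
rewrite (@common_imset_facetP R n 1 (fun=> pi)) // => [|f].
  split=> -[c [b [c0 hb ->]]]; exists c, b; split=> //.
  exact: hb ord0.
rewrite supermodular_imsetP //; split=> h b hb; apply: h => //.
exact: hb ord0.
Qed.

(** A facet of every cone is a priori a multiple of one imset for each order;
    comparing norms identifies the factors, hence the imsets. *)
Lemma common_facetP (R : realType) (n m : nat) (pi : 'I_m -> 'I_n -> rel bool)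
    (a : fun_space R n) : (0 < m)%N ->
  (forall s i, linear_order (pi s i)) ->
  (forall s, facet_inequality (supermodular_cone (pi s)) a) <->
    exists c b, [/\ 0 < c, common_imset pi b & a = c *: b].
Proof.
move=> m_gt0 lin; split=> [a_facet|[c [b [c0 b_common ->]]] s]; last first.
  by apply/supermodular_facetP => //; exists c, b; split.
have [c [b [c0 b_imset aE]]] :=
  (supermodular_facetP a (lin _)).1 (a_facet (Ordinal m_gt0)).
exists c, b; split=> // s.
have [c' [b' [c'0 b'_imset aE']]] :=
  (supermodular_facetP a (lin s)).1 (a_facet s).
suff cE : c = c'.
  have -> : b = b'; last by [].
  by apply: (scalerI (lt0r_neq0 c0)); rewrite -aE aE' cE.
have : dot a a = dot a a by [].
rewrite {1 2}aE aE' !dotZl !dotZr (imset_norm b_imset) (imset_norm b'_imset).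
by move=> cc; apply/eqP; rewrite -(eqrXn2 (n := 2)) ?ltW //; apply/eqP; lra.
Qed.

Theorem theorem8 (R : realType) (n m : nat) (pi : 'I_m -> 'I_n -> rel bool)
    (m_gt0 : (0 < m)%N)
    (pi_linear : forall (s : 'I_m) (i : 'I_n), linear_order (pi s i)) :
  let L : 'I_m -> set (fun_space R n) := fun s => supermodular_cone (pi s) in
  [/\ polyhedral_cone (minkowski_sum L),
      forall f : fun_space R n, minkowski_sum L f <->
        (forall a : fun_space R n,
           (forall s : 'I_m, facet_inequality (L s) a) -> 0 <= dot a f),
      forall a : fun_space R n, facet_inequality (minkowski_sum L) a <->
        (forall s : 'I_m, facet_inequality (L s) a)
    & forall a : fun_space R n, facet_inequality (minkowski_sum L) a <->
        (exists (c : R) (b : fun_space R n),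
           [/\ 0 < c, forall s : 'I_m, imset_inequality (pi s) b & a = c *: b])].
Proof.
move=> L.
have LP := @minkowski_sum_imsetP R n m pi m_gt0 pi_linear.
have facetP := common_imset_facetP m_gt0 LP.
have commonP a := @common_facetP R n m pi a m_gt0 pi_linear.
split=> [|f|a|a].
- have [B BE] := @common_imset_finite R n m pi m_gt0.
  by exists B => f; rewrite LP; split=> h b /BE; apply: h.
- rewrite LP; split=> [f_common a /commonP [c [b [c0 hb ->]]]|f_facet b hb].
    by rewrite dotZl mulr_ge0 ?f_common // ltW.
  by apply/f_facet/commonP; exists 1, b; rewrite scale1r.
- by rewrite facetP commonP.
- exact: facetP.
Qed.
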